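(* Let $n\ge1$ and let $\mathcal{L}$ be the vertex labeling of the linear representation of some linked cycle on $[n]$. Let $LC_n(\mathcal{L})$ be the set of linked cycles on $[n]$ whose linear representation has vertex labeling $\mathcal{L}$. Call the vertices of $\mathcal{L}$ labeled $i^{(j)}$ with $j\ge1$ that are not isolated points left endpoints, and the vertices labeled $i^{(0)}$ right endpoints. For a left endpoint $v$ let $h(v)$ be the number of right endpoints to the right of $v$ minus the number of left endpoints to the right of $v$. Then $$\sum_{\hat\pi\in LC_n(\mathcal{L})}x^{cr_2(\hat\pi)}y^{ne_2(\hat\pi)}=\sum_{\hat\pi\in LC_n(\mathcal{L})}x^{ne_2(\hat\pi)}y^{cr_2(\hat\pi)}=\prod_{v}\left(x^{h(v)-1}+x^{h(v)-2}y+\cdots+xy^{h(v)-2}+y^{h(v)-1}\right),$$ the product being over all left endpoints $v$ of $\mathcal{L}$. In particular $cr_2$ and $ne_2$ have a symmetric joint distribution over $LC_n(\mathcal{L})$.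
   Context: Two finite sets of integers $E,F$ are nearly disjoint if for every $i\in E\cap F$ either ($i=\min(E)$, $|E|>1$, $i\ne\min(F)$) or ($i=\min(F)$, $|F|>1$, $i\ne\min(E)$). A linked partition of $[n]$ is a set of nonempty subsets (blocks) of $[n]$ with union $[n]$, any two distinct blocks nearly disjoint; each element lies in one or two blocks (singly/doubly covered). A linked cycle on $[n]$ is a linked partition of $[n]$ with a cyclic arrangement of each block; a cycle is written $(i_1i_2\dots i_t)$ with $i_1$ its minimum. Linear representation of a linked cycle $\hat\pi$: for each $i\in[n]$ create vertices: if $i$ is singly covered and the minimum of its cycle, of size $k+1$, create $i^{(1)},\dots,i^{(k)}$ if $k\ge1$, and a single isolated vertex $i^{(1)}$ if $k=0$; if $i$ is singly covered and not the minimum of its cycle, create $i^{(0)}$; if $i$ is doubly covered and the minimum of a cycle of size $k+1$, create $i^{(0)},i^{(1)},\dots,i^{(k)}$. Vertices lie on a line ordered by $i$, then by superscript. For each cycle $(i_1\dots i_t)$, $t\ge2$, draw arcs $(i_1^{(j)},i_{t+1-j}^{(0)})$, $j=1,\dots,t-1$. The vertex labeling is the left-to-right sequence of vertex labels. Two arcs $(x_1,y_1),(x_2,y_2)$ form a 2-crossing if the vertices appear in the order $x_1,x_2,y_1,y_2$, and a 2-nesting if in the order $x_1,x_2,y_2,y_1$; $cr_2(\hat\pi)$, $ne_2(\hat\pi)$ are the numbers of these.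
   Formalization: The vertex labeling is taken to record also which vertices are isolated points; with bare labels, (1)(23) and (13)(2) share 1^(1),2^(1),3^(0), so the left endpoints are not determined by the labeling and the sum would be 2 while the product is 1. *)

(* Defs.v *)
From mathcomp Require Import all_boot all_order all_algebra.
Set Implicit Arguments. Unset Strict Implicit. Unset Printing Implicit Defensive.
Import GRing.Theory.

(* A cycle is a nonempty duplicate-free list (i_1 i_2 ... i_t) of integers
   whose head i_1 is its minimum; a linked cycle on [n] is represented
   canonically as the list of its cycles sorted by (strictly increasing)
   minima (minima of distinct blocks are distinct, see nearly_disjoint). *)

Definition cmin (C : seq nat) : nat := head 0 C.

Definition is_cycle (n : nat) (C : seq nat) : bool :=
  [&& C != [::], uniq C, all (fun i => (1 <= i <= n)%N) C
    & all (fun i => (cmin C <= i)%N) C].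

Definition nearly_disjoint (E F : seq nat) : bool :=
  all (fun i =>
         [&& i == cmin E, (1 < size E)%N & i != cmin F]
      || [&& i == cmin F, (1 < size F)%N & i != cmin E])
      [seq i <- E | i \in F].

Definition is_linked_cycle (n : nat) (c : seq (seq nat)) : bool :=
  [&& all (is_cycle n) c,
      all (fun i => (1 <= count (fun C => i \in C) c <= 2)%N) (iota 1 n),
      pairwise nearly_disjoint c
    & sorted ltn (map cmin c)].

Fixpoint tuples (T : Type) (A : seq T) (m : nat) : seq (seq T) :=
  if m is m'.+1 then [seq a :: s | a <- A, s <- tuples A m'] else [:: [::]].

Definition upto (T : Type) (A : seq T) (k : nat) : seq (seq T) :=
  flatten [seq tuples A m | m <- iota 0 k.+1].

Definition cand_lc (n : nat) : seq (seq (seq nat)) :=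
  upto (upto (iota 1 n) n) n.

(* The (duplicate-free) list of all linked cycles on [n]. *)
Definition linked_cycles (n : nat) : seq (seq (seq nat)) :=
  [seq c <- cand_lc n | is_linked_cycle n c].

(* Vertex labels: (i, j, isolated) stands for i^(j); the boolean flag
   records whether the vertex is an isolated point. *)
Definition label := (nat * nat * bool)%type.

Definition vertices_of (c : seq (seq nat)) (i : nat) : seq label :=
  let Cs := [seq C <- c | i \in C] in
  let Cmin := nth [::] Cs (find (fun C => cmin C == i) Cs) in
  if size Cs == 1 then
    let C := head [::] Cs in
    if cmin C == i then
      (if size C == 1 then [:: (i, 1, true)]
       else [seq (i, j, false) | j <- iota 1 (size C).-1])
    else [:: (i, 0, false)]
  else if size Cs == 2 then
    [seq (i, j, false) | j <- iota 0 (size Cmin)]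
  else [::].

Definition labeling (n : nat) (c : seq (seq nat)) : seq label :=
  flatten [seq vertices_of c i | i <- iota 1 n].

(* arcs (i_1^(j), i_(t+1-j)^(0)), j = 1..t-1, vertices as (i, j) *)
Definition cycle_arcs (C : seq nat) : seq ((nat * nat) * (nat * nat)) :=
  [seq ((cmin C, j), (nth 0 C (size C - j), 0)) | j <- iota 1 (size C).-1].

Definition arcs (c : seq (seq nat)) := flatten (map cycle_arcs c).

Definition vlt (a b : nat * nat) : bool :=
  (a.1 < b.1)%N || ((a.1 == b.1) && (a.2 < b.2)%N).

Definition cr2 (c : seq (seq nat)) : nat :=
  count (fun p : _ * _ => let: (a, b) := p in
           [&& vlt a.1 b.1, vlt b.1 a.2 & vlt a.2 b.2])
        (allpairs pair (arcs c) (arcs c)).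

Definition ne2 (c : seq (seq nat)) : nat :=
  count (fun p : _ * _ => let: (a, b) := p in
           [&& vlt a.1 b.1, vlt b.1 b.2 & vlt b.2 a.2])
        (allpairs pair (arcs c) (arcs c)).

Definition is_lend (v : label) : bool := (1 <= v.1.2)%N && ~~ v.2.
Definition is_rend (v : label) : bool := v.1.2 == 0%N.

Definition hval (L : seq label) (k : nat) : nat :=
  count is_rend (drop k.+1 L) - count is_lend (drop k.+1 L).

Definition hpoly (R : comPzRingType) (x y : R) (h : nat) : R :=
  \sum_(k < h) x ^+ (h.-1 - k) * y ^+ k.

(* Main.v *)
(* Given the labeling, a linked cycle is the same thing as a perfect matching of
   left endpoints to right endpoints further right: the labeling determines the
   minimum and the size of every cycle, and the partners of i^(1), ..., i^(k)
   spell out the rest of the cycle with minimum i, backwards.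
   Build such a matching from the rightmost left endpoint to the leftmost. When
   v is treated, exactly h(v) right endpoints to its right are still free, and
   all of them but the partner w of v will be matched to left endpoints before
   v. Those smaller than w give crossings with (v, w), those larger give
   nestings, so the choices for w contribute the factor
   x^(h-1) + x^(h-2) y + ... + y^(h-1), whatever was chosen before. *)
Require Import Defs.
From mathcomp Require Import all_boot all_order all_algebra.
Import GRing.Theory.
Local Open Scope ring_scope.

Set Implicit Arguments.
Unset Strict Implicit.
Unset Printing Implicit Defensive.

(** * Enumeration of lists and of matchings *)

Lemma mem_tuples (T : eqType) (A : seq T) m s :
  (s \in tuples A m) = (size s == m) && all (mem A) s.
Proof.
elim: m s => [|m IH] [|a s] //=; first by apply/allpairsP => -[[? ?] []].
apply/allpairsP/idP => [[[b t] /= [bA tA [-> ->]]]|].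
  by move: tA; rewrite IH eqSS bA => /andP[-> ->].
by rewrite eqSS => /and3P[sm aA sA]; exists (a, s); split; rewrite //= IH sm.
Qed.

Lemma uniq_tuples (T : eqType) (A : seq T) m : uniq A -> uniq (tuples A m).
Proof.
move=> uA; elim: m => //= m IH.
by apply: allpairs_uniq => // -[a s] [b t] _ _ /= [-> ->].
Qed.

Lemma mem_upto (T : eqType) (A : seq T) k s :
  (s \in upto A k) = (size s <= k)%N && all (mem A) s.
Proof.
apply/flattenP/andP => [[_ /mapP[m mk ->]]|[sk sA]].
  by rewrite mem_tuples => /andP[/eqP -> ->]; move: mk; rewrite mem_iota.
exists (tuples A (size s)); last by rewrite mem_tuples eqxx.
by apply: map_f; rewrite mem_iota.
Qed.

Lemma uniq_upto (T : eqType) (A : seq T) k : uniq A -> uniq (upto A k).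
Proof.
move=> uA; rewrite /upto; elim: k.+1 0%N => //= {}k IH m.
rewrite cat_uniq uniq_tuples // IH andbT /=; apply/hasPn => s.
case/flattenP=> _ /mapP[j + ->]; rewrite mem_iota => /andP[mj _].
by rewrite !mem_tuples => /andP[/eqP -> _]; rewrite negb_and gtn_eqF.
Qed.

(* [ls] lists the left endpoints from right to left; a matching lists their
   partners in the same order. *)
Fixpoint matchings (ls rs : seq nat) : seq (seq nat) :=
  if ls is v :: ls' then
    flatten [seq [seq w :: f | f <- matchings ls' (rem w rs)]
            | w <- rs & (v < w)%N]
  else [:: [::]].

(** Equal lengths make the recursion end with no right endpoint left over, so a matching uses all of
    [rs]. *)
Lemma mem_matchings ls rs f : size ls = size rs ->
  (f \in matchings ls rs) = perm_eq f rs && all2 ltn ls f.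
Proof.
elim: ls rs f => [|v ls IH] rs f /=.
  by move=> /esym/size0nil ->; case: f => [|a f]; rewrite inE //= andbF.
move=> srs; apply/flattenP/andP.
  case=> _ /mapP[w + ->] /mapP[g + ->]; rewrite mem_filter => /andP[vw wrs].
  rewrite IH; last by rewrite size_rem // -srs.
  case/andP=> pg ag; split; last by rewrite /= vw.
  by rewrite perm_sym (permPl (perm_to_rem wrs)) perm_cons perm_sym.
case: f => [|w f] /=; first by case=> _.
case=> pf /andP[vw af].
have wrs : w \in rs by rewrite -(perm_mem pf) mem_head.
exists [seq w :: g | g <- matchings ls (rem w rs)].
  by apply/mapP; exists w; rewrite // mem_filter vw.
apply: map_f; rewrite IH ?size_rem -?srs // af andbT.
by rewrite -(perm_cons w) (permPl pf) perm_to_rem.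
Qed.

Lemma uniq_matchings ls rs : uniq rs -> uniq (matchings ls rs).
Proof.
elim: ls rs => //= v ls IH rs urs.
have : uniq [seq w <- rs | (v < w)%N] by rewrite filter_uniq.
elim: [seq w <- rs | _] => //= w ws IHw /andP[wws uws].
rewrite cat_uniq IHw // andbT map_inj_uniq ?IH ?rem_uniq //=; last by move=> ? ? [].
apply/hasPn => _ /flattenP[_ /mapP[u uws' ->] /mapP[g _ ->]].
by apply/mapP => -[g' _ [uw _]]; move: wws; rewrite -uw uws'.
Qed.

(** The entries of [f'] are partners of left endpoints before [v], so an arc ending in [u] crosses
    [(v, w)] exactly when [v < u < w]; in [matching_ne], it encloses [(v, w)] exactly when
    [w < u]. *)
Fixpoint matching_cr (ls f : seq nat) : nat :=
  if (ls, f) is (v :: ls', w :: f') then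
    (count (fun u => (v < u < w)%N) f' + matching_cr ls' f')%N
  else 0%N.

Fixpoint matching_ne (ls f : seq nat) : nat :=
  if (ls, f) is (v :: ls', w :: f') then
    (count (ltn w) f' + matching_ne ls' f')%N
  else 0%N.

(** * Generating function of matchings by crossings and nestings *)

Lemma hpolyC (R : comPzRingType) (x y : R) h : hpoly x y h = hpoly y x h.
Proof.
rewrite /hpoly (reindex_inj rev_ord_inj); apply: eq_bigr => -[k kh] _ /=.
by rewrite mulrC; congr (_ ^+ _ * _ ^+ _); move: kh; case: h => //= h kh; rewrite ?subSS ?subKn.
Qed.

(** Both sides depend on [W] only up to order, so [W] may be sorted. Its least element contributes a
    pure power of [y], and each other element gains one factor [x] from it, a recursion that [hpoly]
    also satisfies. *)
Lemma sum_ranks (R : comPzRingType) (x y : R) (W : seq nat) : uniq W ->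
  \sum_(w <- W) x ^+ count (fun u => (u < w)%N) W * y ^+ count (ltn w) W
    = hpoly x y (size W).
Proof.
move=> uW; have [s pWs ss] : exists2 s, perm_eq W s & sorted ltn s.
  exists (sort leq W); first by rewrite perm_sym perm_sort.
  by rewrite ltn_sorted_uniq_leq sort_uniq uW (sort_sorted leq_total).
rewrite (perm_big _ pWs) (perm_size pWs) /=.
under eq_bigr do rewrite !(permP pWs).
elim: s ss {pWs uW W} => [|w s IH] /=; first by rewrite big_nil /hpoly big_ord0.
move=> sw; have aw := order_path_min ltn_trans sw.
have ws : {in s, forall u, (w < u)%N} by apply/allP.
rewrite big_cons /= ltnn (eq_in_count (a2 := pred0)) ?count_pred0; last first.
  by move=> u /ws wu /=; rewrite ltnNge ltnW.
have -> : count (ltn w) s = size s by apply/eqP; rewrite -all_count.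
rewrite expr0 mul1r /hpoly big_ord_recr /= subnn expr0 mul1r addrC add0n.
congr (_ + _); rewrite -[RHS]/(\sum_(i < size s) x ^+ (size s - i) * y ^+ i).
transitivity (x * hpoly x y (size s)); last first.
  rewrite /hpoly big_distrr; apply: eq_bigr => -[k ks] _ /=.
  by rewrite mulrA -exprS -subSn ?prednK //; case: (size s) ks.
rewrite -IH ?(path_sorted sw) // big_distrr /= big_seq [RHS]big_seq.
apply: eq_bigr => u /ws wu; rewrite wu [(u < w)%N]ltnNge (ltnW wu) /=.
by rewrite add0n add1n exprS mulrA.
Qed.

(** As [ls] is weakly decreasing, a partner chosen earlier lies to the right of every later left
    endpoint. Hence exactly [k] of the right endpoints beyond the left endpoint of index [k] are
    already taken. *)
Lemma sum_matchings (R : comPzRingType) (x y : R) ls rs :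
  size ls = size rs -> uniq rs -> sorted geq ls ->
  \sum_(f <- matchings ls rs) x ^+ matching_cr ls f * y ^+ matching_ne ls f
    = \prod_(k < size ls) hpoly x y (count (ltn (nth 0%N ls k)) rs - k).
Proof.
elim: ls rs => [|v ls IH] rs /=.
  by rewrite big_seq1 big_ord0 !expr0 mulr1.
move=> srs urs sls; rewrite big_flatten big_map big_filter big_ord_recl /=.
rewrite subn0 -size_filter -sum_ranks ?filter_uniq // big_distrl /= big_filter.
rewrite big_seq_cond [RHS]big_seq_cond; apply: eq_bigr => w /andP[wrs vw].
rewrite big_map.
have urw : uniq (rem w rs) by rewrite rem_uniq.
have srw : size ls = size (rem w rs) by rewrite size_rem // -srs.
(* Every continuation [f] is an arrangement of [rem w rs], so the crossings and nestings with
   [(v, w)] depend on [w] alone and factor out. *)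
transitivity (x ^+ count (fun u => (u < w)%N) [seq w <- rs | (v < w)%N] *
   y ^+ count (ltn w) [seq w <- rs | (v < w)%N] *
   \sum_(f <- matchings ls (rem w rs)) x ^+ matching_cr ls f * y ^+ matching_ne ls f).
  rewrite big_distrr /= big_seq [RHS]big_seq; apply: eq_bigr => f.
  rewrite mem_matchings // => /andP[pf _].
  have pwf : perm_eq rs (w :: f).
    by rewrite (permPl (perm_to_rem wrs)) perm_cons perm_sym.
  rewrite /= !exprD mulrACA !count_filter !(permP pwf) /= !ltnn /= !add0n.
  congr (_ ^+ _ * _ ^+ _ * _).
    by apply: eq_count => u /=; rewrite andbC.
  apply: eq_count => u /=; rewrite andb_idr // => wu.
  exact: ltn_trans wu.
congr (_ * _); rewrite IH //; last exact: path_sorted sls.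
apply: eq_bigr => k _; rewrite /bump /= add1n.
congr (hpoly _ _ _).
rewrite -/(nth 0%N (v :: ls) k.+1) (permP (perm_to_rem wrs)) /=.
have -> : (nth 0%N ls k < w)%N.
  apply: leq_ltn_trans vw.
  have : all (geq v) ls by apply: order_path_min sls => a b c /= ba cb; apply: leq_trans ba.
  by move/all_nthP; apply.
by rewrite add1n subSS.
Qed.

(** * Crossings, nestings and heights read from the right *)

Lemma vlt_irr v : vlt v v = false.
Proof. by rewrite /vlt !ltnn andbF. Qed.

Lemma vlt_trans : transitive vlt.
Proof.
move=> [a b] [c d] [e f]; rewrite /vlt /=.
case/orP=> [ca|/andP[/eqP -> db]] /orP[ae|/andP[/eqP <- bf]].
- by rewrite (ltn_trans ca).
- by rewrite ca.
- by rewrite ae.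
- by rewrite eqxx (ltn_trans db) // orbT.
Qed.

Lemma vltNgt u v : vlt u v -> vlt v u = false.
Proof. by move=> uv; apply/negP => /(vlt_trans uv); rewrite vlt_irr. Qed.

(** Meant for [a] the arc with the rightmost left endpoint, which is never the first arc of a
    crossing or nesting. *)
Lemma count_allpairs_cons (T : eqType) (P : pred (T * T)) a s :
    {in a :: s, forall b, ~~ P (a, b)} ->
  count P (allpairs pair (a :: s) (a :: s))
    = (count (fun b => P (b, a)) s + count P (allpairs pair s s))%N.
Proof.
move=> Pa; rewrite -[allpairs pair (a :: s) _]/([seq (a, b) | b <- a :: s] ++ _) count_cat.
have /permP -> : perm_eq (allpairs pair s (a :: s))
    ([seq (b, a) | b <- s] ++ allpairs pair s s).
  exact/permPl/(perm_allpairs_consr pair s (fun=> a) (fun=> s)).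
rewrite count_cat !count_map (eq_in_count (a2 := pred0)) ?count_pred0 //.
by move=> b /Pa /negbTE /= ->.
Qed.

Section ArcStatistics.

Variable A : seq ((nat * nat) * (nat * nat)).
Hypothesis A_sorted : pairwise (fun a b => vlt b.1 a.1) A.
Hypothesis A_arc : {in A, forall a, a.2.2 = 0%N /\ (a.1.1 < a.2.1)%N}.

(** Arcs end in vertices with superscript 0, and such a vertex lies to the right of another vertex
    only if its integer is larger. So comparing any vertex with a right endpoint on its right is a
    comparison of integers. *)
Lemma crossings_from_right :
  count (fun p : _ * _ => let: (a, b) := p in
           [&& vlt a.1 b.1, vlt b.1 a.2 & vlt a.2 b.2]) (allpairs pair A A)
    = matching_cr [seq a.1.1 | a <- A] [seq a.2.1 | a <- A].
Proof.
elim: A A_sorted A_arc => // a s IH; rewrite pairwise_cons => /andP[/allP sa ss] arc.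
rewrite count_allpairs_cons; last first.
  move=> b; rewrite inE => /predU1P[->|/sa /vltNgt ab]; first by rewrite vlt_irr.
  by rewrite ab.
rewrite IH // => [|b bs]; last by apply: arc; rewrite inE bs orbT.
congr addn; rewrite count_map; apply: eq_in_count => b bs /=.
have [a0 _] := arc a (mem_head _ _).
have [b0 _] := arc b (@mem_behead _ (a :: s) b bs).
by rewrite sa // /vlt a0 b0 !ltn0 !andbF !orbF.
Qed.

Lemma nestings_from_right :
  count (fun p : _ * _ => let: (a, b) := p in
           [&& vlt a.1 b.1, vlt b.1 b.2 & vlt b.2 a.2]) (allpairs pair A A)
    = matching_ne [seq a.1.1 | a <- A] [seq a.2.1 | a <- A].
Proof.
elim: A A_sorted A_arc => // a s IH; rewrite pairwise_cons => /andP[/allP sa ss] arc.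
rewrite count_allpairs_cons; last first.
  move=> b; rewrite inE => /predU1P[->|/sa /vltNgt ab]; first by rewrite vlt_irr.
  by rewrite ab.
rewrite IH // => [|b bs]; last by apply: arc; rewrite inE bs orbT.
congr addn; rewrite count_map; apply: eq_in_count => b bs /=.
have [a0 aa] := arc a (mem_head _ _).
have [b0 _] := arc b (@mem_behead _ (a :: s) b bs).
by rewrite sa // /vlt a0 b0 !ltn0 !andbF !orbF aa.
Qed.

End ArcStatistics.

Definition lends (L : seq label) : seq nat := [seq v.1.1 | v <- L & is_lend v].
Definition rends (L : seq label) : seq nat := [seq v.1.1 | v <- L & is_rend v].

(** Counted from the right, the left endpoint of index [k] has [k] left endpoints to its right. As
    [i^(0)] precedes all other vertices of [i], the right endpoints to its right are those with a
    larger integer. *)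
Lemma prod_hval (R : comPzRingType) (x y : R) (L : seq label) :
    pairwise (fun u v => vlt u.1 v.1) L ->
  \prod_(k < size L | is_lend (nth (0%N, 0%N, false) L k)) hpoly x y (hval L k)
    = \prod_(k < size (lends L))
        hpoly x y (count (ltn (nth 0%N (rev (lends L)) k)) (rends L) - k).
Proof.
elim: L => [|v L IH] /=; first by rewrite !big_ord0.
case/andP=> /allP vL sL; rewrite big_mkcond big_ord_recl /= -big_mkcond /=.
have -> : \prod_(i < size L | is_lend (nth (0%N, 0%N, false) L i))
    hpoly x y (hval (v :: L) (bump 0 i))
    = \prod_(k < size L | is_lend (nth (0%N, 0%N, false) L k))
        hpoly x y (hval L k) by [].
rewrite IH // /lends /rends /=.
(* If the new first vertex [v] is a right endpoint, it adds nothing to the counts for the left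
   endpoints after it. *)
have nthL k : (k < size (lends L))%N -> (v.1.1 <= nth 0%N (rev (lends L)) k)%N.
  move=> kL; have : nth 0%N (rev (lends L)) k \in lends L.
    by rewrite -mem_rev mem_nth // size_rev.
  case/mapP=> u; rewrite mem_filter => /andP[_ /vL + ->].
  by case/orP=> [/ltnW //|/andP[/eqP ->]].
case: ifP => [lv|_].
  have /negbTE -> : ~~ is_rend v by case/andP: lv; rewrite /is_rend -lt0n.
  rewrite /= big_ord_recr /= rev_cons mulrC; congr (_ * _).
    by apply: eq_bigr => k _; rewrite nth_rcons size_rev ltn_ord.
  rewrite nth_rcons size_rev ltnn eqxx /hval /= drop0 !size_map !size_filter.
  congr (hpoly _ _ (_ - _)); rewrite count_map count_filter.
  apply: eq_in_count => u /vL /=; rewrite /is_rend /vlt.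
  case: (eqVneq u.1.2 0%N) => [->|_]; last by rewrite andbF.
  by rewrite ltn0 andbF orbF => ->.
rewrite mul1r; case: ifP => // _; apply: eq_bigr => k _ /=.
by rewrite ltnNge nthL.
Qed.

(** * Linked cycles in terms of minima, sizes and non-minimal elements *)

Definition shapes (c : seq (seq nat)) : seq (nat * nat) :=
  [seq (cmin C, size C) | C <- c].

Definition nonmins (c : seq (seq nat)) : seq nat := flatten (map behead c).

Definition min_first (C : seq nat) : bool :=
  (C != [::]) && all (ltn (cmin C)) (behead C).

(* With [S] the minima and sizes of the cycles and [B] their non-minimal
   elements: being a linked cycle constrains nothing else, apart from
   [min_first]. *)
Definition compatible (n : nat) (S : seq (nat * nat)) (B : seq nat) : bool :=
  [&& sorted ltn (map fst S), uniq B,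
      all (fun i => (i \in map fst S) || (i \in B)) (iota 1 n),
      all (mem (iota 1 n)) (map fst S ++ B)
    & all (fun s => (s.2 == 1%N) ==> (s.1 \notin B)) S].

Lemma perm_compatible n S B B' : perm_eq B B' -> compatible n S B = compatible n S B'.
Proof.
move=> pB; have mB := perm_mem pB; rewrite /compatible (perm_uniq pB).
rewrite !all_cat (perm_all _ pB); congr [&& _, _, _, _ & _].
  by apply: eq_all => i; rewrite mB.
by apply: eq_all => s; rewrite mB.
Qed.

Lemma map_fst_shapes c : map fst (shapes c) = map cmin c.
Proof. by rewrite -map_comp. Qed.

Lemma min_firstP C : min_first C -> exists D, C = cmin C :: D /\ all (ltn (cmin C)) D.
Proof. by case: C => // m D /= mD; exists D. Qed.

Lemma mem_cycle C i : min_first C -> (i \in C) = (i == cmin C) || (i \in behead C).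
Proof. by case/min_firstP=> D [-> _]; rewrite inE. Qed.

Lemma behead_gt C i : min_first C -> i \in behead C -> (cmin C < i)%N.
Proof. by case/andP=> _ /allP; apply. Qed.

Lemma uniq_flatten_inj (T T' : eqType) (g : T -> seq T') c C F i :
  uniq (flatten (map g c)) -> C \in c -> F \in c -> i \in g C -> i \in g F -> C = F.
Proof.
elim: c => //= X c IH; rewrite cat_uniq => /and3P[_ /hasPn dis uc].
have notX Y : Y \in c -> i \in g Y -> i \notin g X.
  by move=> Yc iY; apply: dis; apply/flatten_mapP; exists Y.
rewrite !inE => /predU1P[->|Cc] /predU1P[->|Fc] iC iF //.
- by move: (notX _ Fc iF); rewrite iC.
- by move: (notX _ Cc iC); rewrite iF.
- exact: IH.
Qed.

Lemma uniq_map_inj (T T' : eqType) (g : T -> T') c :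
  uniq (map g c) -> {in c &, injective g}.
Proof.
rewrite -flatten_map1 => uc C F Cc Fc gCF.
by apply: (uniq_flatten_inj (i := g C) uc) => //=; rewrite inE gCF.
Qed.

Lemma nearly_disjointP E F :
  reflect (forall i, i \in E -> i \in F ->
    [&& i == cmin E, (1 < size E)%N & i != cmin F]
      || [&& i == cmin F, (1 < size F)%N & i != cmin E])
    (nearly_disjoint E F).
Proof.
apply: (iffP allP) => [nd i iE iF|nd i]; first by apply: nd; rewrite mem_filter iF.
by rewrite mem_filter => /andP[iF iE]; apply: nd.
Qed.

Lemma nearly_disjointC E F : nearly_disjoint E F = nearly_disjoint F E.
Proof.
by apply/nearly_disjointP/nearly_disjointP => nd i iE iF; rewrite orbC nd.
Qed.

Lemma in_pairwise (T : eqType) (r : rel T) s : symmetric r -> uniq s ->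
  pairwise r s <-> {in s &, forall x y, x != y -> r x y}.
Proof.
move=> sr; elim: s => //= a s IH /andP[as_ /IH {}IH]; split.
  case/andP=> /allP ra /IH rs x y; rewrite !inE.
  case/predU1P=> [->|xs] /predU1P[->|ys]; first by rewrite eqxx.
  - by move=> _; apply: ra.
  - by move=> _; rewrite sr; apply: ra.
  - exact: rs.
move=> rs; apply/andP; split.
  apply/allP => y ys; apply: rs; rewrite ?inE ?eqxx ?ys ?orbT //.
  by apply: contraNneq as_ => ->.
by apply/IH => x y xs ys; apply: rs; rewrite inE ?xs ?ys orbT.
Qed.

(** No element is both the minimum and a tail entry of one cycle, and it can play each role in at
    most one cycle. Doubly covered thus means playing both roles. *)
Lemma count_cover n c i : all min_first c -> compatible n (shapes c) (nonmins c) ->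
  count (fun C => i \in C) c = ((i \in map cmin c) + (i \in nonmins c))%N.
Proof.
move=> /allP mf /and5P[+ ub _ _ _]; rewrite map_fst_shapes => smin.
rewrite -count_uniq_mem; last exact: sorted_uniq ltn_trans ltnn _ smin.
rewrite -count_uniq_mem //; move: mf ub; rewrite /nonmins; clear smin.
elim: c => //= C c IH mf; rewrite cat_uniq => /and3P[uC _ uc].
rewrite IH //; last by move=> F Fc; apply: mf; rewrite inE Fc orbT.
rewrite count_cat mem_cycle ?mf ?mem_head // (count_uniq_mem _ uC).
rewrite addnACA [cmin C == i]eq_sym; congr addn.
case: eqP => // -> /=; case: (boolP (_ \in _)) => //.
by move/(behead_gt (mf _ (mem_head _ _))); rewrite ltnn.
Qed.

(** Near-disjointness makes a common element of two cycles the minimum of one, of size at least two,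
    and a tail entry of the other. Given distinct minima, this amounts to tail entries being
    distinct and avoiding the cycles of size one. *)
Lemma linked_cycleE n c :
  is_linked_cycle n c = all min_first c && compatible n (shapes c) (nonmins c).
Proof.
rewrite /compatible map_fst_shapes; apply/and4P/andP.
  case=> /allP cyc /allP cov nd smin.
  have mf : {in c, forall C, min_first C}.
    move=> C /cyc /and4P[C0 uC _]; case: C C0 uC => // m D _ /= /andP[mD _].
    case/andP=> _ /allP mD'; apply/allP => i iD /=; rewrite ltn_neqAle mD' //.
    by rewrite andbT; apply: contraNneq mD => ->.
  have uc : uniq (map cmin c) := sorted_uniq ltn_trans ltnn smin.
  have ucc := map_uniq uc.
  have {}nd := (in_pairwise nearly_disjointC ucc).1 nd.
  have rng C i : C \in c -> i \in C -> i \in iota 1 n.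
    move=> /cyc /and4P[_ _ /allP rC _] /rC; by rewrite mem_iota add1n ltnS.
  split; first exact/allP.
  apply/and5P; split=> //.
  (* An element in the tails of two cycles would be common to both and the minimum of neither. *)
  - have {}cyc : {in c, forall C, uniq (behead C)}.
      by move=> [|m D] /cyc /and4P[_ //=] /andP[].
    rewrite /nonmins; elim: c cyc mf ucc nd {cov smin uc rng} => //= C c IH.
    move=> cyc mf /andP[Cc uc] nd; rewrite cat_uniq cyc ?mem_head //=.
    have tl (F : seq nat) : F \in c -> F \in C :: c by rewrite inE orbC => ->.
    rewrite IH // => [|F /tl /cyc //|F /tl /mf //|F G /tl Fc /tl Gc]; last exact: nd.
    rewrite andbT; apply/hasPn => i /flatten_mapP[F Fc iF]; apply/negP => iC.
    have CF : C != F by apply: contraNneq Cc => ->.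
    have mC := mf _ (mem_head _ _); have mF := mf _ (tl _ Fc).
    have /nearly_disjointP/(_ i) := nd _ _ (mem_head _ _) (tl _ Fc) CF.
    rewrite (mem_cycle _ mC) (mem_cycle _ mF) iF iC !orbT => /(_ isT isT).
    by rewrite !gtn_eqF ?behead_gt.
  - apply/allP => i /cov /andP[]; rewrite -has_count => /hasP[C Cc + _].
    rewrite mem_cycle ?mf // => /predU1P[->|iC]; first by rewrite map_f.
    by apply/orP; right; apply/flatten_mapP; exists C.
  - rewrite all_cat; apply/andP; split; apply/allP => i.
      case/mapP=> C Cc ->; apply: (rng C) => //.
      by rewrite mem_cycle ?mf // eqxx.
    case/flatten_mapP=> C Cc iC; apply: (rng C) => //.
    by rewrite mem_cycle ?mf // iC orbT.
  (* If a one-element cycle met the tail of another cycle, near-disjointness would require its size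
     to exceed one. *)
  apply/allP => _ /mapP[C Cc ->] /=; apply/implyP => /eqP sC.
  apply/negP => /flatten_mapP[F Fc iF].
  have CF : C != F.
    apply: contraTneq iF => <-; apply/negP => /(behead_gt (mf _ Cc)).
    by rewrite ltnn.
  have /nearly_disjointP/(_ (cmin C)) := nd _ _ Cc Fc CF.
  rewrite (mem_cycle _ (mf _ Cc)) (mem_cycle _ (mf _ Fc)) eqxx iF orbT sC => /(_ isT isT) /=.
  by rewrite !andbF.
case=> mf; rewrite -map_fst_shapes => cmp; have cov := count_cover _ mf cmp.
case/and5P: cmp => smin uB /allP icov /allP rng /allP sing.
move: smin icov rng; rewrite map_fst_shapes => smin icov rng.
have uc : uniq (map cmin c) := sorted_uniq ltn_trans ltnn smin.
have {}mf := allP mf.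
split=> //.
- apply/allP => C Cc; have mC := mf _ Cc.
  have [D [CE mD]] := min_firstP mC; apply/and4P; split.
  + by rewrite CE.
  + rewrite CE /=; apply/andP; split.
      by apply/negP => /(allP mD) /=; rewrite ltnn.
    have : uniq (behead C).
      move: uB; rewrite /nonmins; elim: (c) Cc => //= F c' IH.
      rewrite cat_uniq inE => /predU1P[->|Cc'] /and3P[//] _ _; exact: IH.
    by rewrite CE.
  + apply/allP => i; rewrite mem_cycle // => iC.
    suff /rng : i \in map cmin c ++ nonmins c by rewrite /= mem_iota add1n ltnS.
    rewrite mem_cat; case/predU1P: iC => [->|iC]; first by rewrite map_f.
    by apply/orP; right; apply/flatten_mapP; exists C.
  + rewrite CE /= leqnn; apply: sub_all mD => i; exact: ltnW.
- apply/allP => i /icov; rewrite cov.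
  by case: (_ \in _); case: (_ \in _).
- apply/(in_pairwise nearly_disjointC (map_uniq uc)) => C F Cc Fc CF.
  have mC := mf _ Cc; have mF := mf _ Fc.
  (* The mixed case: the minimum of [E] is in the tail of [G], so it exceeds [cmin G], and [sing]
     excludes that [E] has size one. *)
  have big E G i : E \in c -> G \in c -> i == cmin E -> i \in behead G ->
      [&& i == cmin E, (1 < size E)%N & i != cmin G].
    move=> Ec Gc /eqP -> iG; rewrite eqxx /= gtn_eqF ?behead_gt ?mf // andbT.
    have /implyP /= := sing _ (map_f (fun C => (cmin C, size C)) Ec).
    have [D [-> _]] := min_firstP (mf _ Ec); case: D => // /(_ isT) /negP[].
    by apply/flatten_mapP; exists G.
  apply/nearly_disjointP => i; rewrite (mem_cycle _ mC) (mem_cycle _ mF).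
  (* A common minimum or a common tail entry would force [C = F]; only the mixed cases survive. *)
  case/orP=> iC /orP[] iF.
  + case/eqP: CF; apply: (uniq_map_inj uc) => //; by rewrite -(eqP iC) (eqP iF).
  + by rewrite big.
  + by rewrite orbC big.
  + by case/eqP: CF; apply: (uniq_flatten_inj uB Cc Fc iC iF).
Qed.

(** * Vertex labelings *)

(* The vertices i^(j), j >= 1, created by a cycle of minimum i = [s.1] and size
   [s.2]. *)
Definition min_block (s : nat * nat) : seq label :=
  if s.2 == 1%N then [:: (s.1, 1%N, true)]
  else [seq (s.1, j, false) | j <- iota 1 s.2.-1].

(** [B] enters only through membership: the labeling forgets how the non-minimal elements are
    distributed over the cycles. *)
Definition vertices_at (S : seq (nat * nat)) (B : seq nat) (i : nat) : seq label :=
  nseq (i \in B) (i, 0%N, false)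
    ++ flatten [seq min_block s | s <- S & s.1 == i].

Lemma filter_shape (S : seq (nat * nat)) s :
  uniq (map fst S) -> s \in S -> [seq t <- S | t.1 == s.1] = [:: s].
Proof.
move=> uS sS; rewrite -(filter_pred1_uniq (map_uniq uS) sS).
apply: eq_in_filter => t tS; apply/eqP/eqP => [|-> //].
exact: (uniq_map_inj uS).
Qed.

Lemma filter_shape0 (S : seq (nat * nat)) i :
  i \notin map fst S -> [seq t <- S | t.1 == i] = [::].
Proof.
move=> iS; rewrite -(filter_pred0 S); apply: eq_in_filter => t tS /=.
by apply: contraNF iS => /eqP <-; apply: map_f.
Qed.

Lemma vertices_ofE n c i :
    all min_first c -> compatible n (shapes c) (nonmins c) -> i \in iota 1 n ->
  vertices_of c i = vertices_at (shapes c) (nonmins c) i.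
Proof.
move=> mf cmp i_n; have cov := count_cover i mf cmp.
case/and5P: cmp => smin _ /allP /(_ _ i_n) icov _ /allP sing.
rewrite /vertices_of /vertices_at size_filter cov.
have uc : uniq (map fst (shapes c)) := sorted_uniq ltn_trans ltnn smin.
case: (boolP (i \in map cmin c)) => [/mapP[C Cc iC]|imin]; last first.
  rewrite map_fst_shapes (negbTE imin) /= in icov.
  rewrite icov /= filter_shape0 ?map_fst_shapes //=.
  have : all (mem c) [seq F <- c | i \in F].
    by apply/allP => F; rewrite mem_filter => /andP[].
  have : size [seq F <- c | i \in F] = 1%N by rewrite size_filter cov (negbTE imin) icov.
  case: [seq F <- c | i \in F] => [|F [|? ?]] //= _; rewrite andbT => Fc.
  by case: eqP => // Fi; move: imin; rewrite -Fi map_f.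
have Ci : C \in [seq F <- c | i \in F].
  by rewrite mem_filter Cc iC mem_cycle ?(allP mf) // eqxx.
have sC : (cmin C, size C) \in shapes c by apply: map_f.
rewrite iC (filter_shape (s := (cmin C, size C))) //= cats0.
case: (boolP (cmin C \in nonmins c)) => CB /=.
  have /implyP/= := sing _ sC; rewrite CB => s1.
  have -> : nth [::] [seq F <- c | cmin C \in F]
      (find (fun F => cmin F == cmin C) [seq F <- c | cmin C \in F]) = C.
    rewrite iC in Ci; have hC : has (fun F => cmin F == cmin C) [seq F <- c | cmin C \in F].
      by apply/hasP; exists C.
    have := nth_find [::] hC; have := mem_nth [::] (etrans (esym (has_find _ _)) hC).
    rewrite mem_filter => /andP[_ Fc] /eqP; apply: uniq_map_inj Fc Cc.
    by rewrite -map_fst_shapes.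
  (* A doubly covered minimum has a cycle of size at least two, so its superscripts are 0 followed
     by those of [min_block]. *)
  rewrite /min_block /=; case: eqP s1 => [_ /(_ isT) //|_ _].
  by have [D [-> _]] := min_firstP (allP mf _ Cc).
have : size [seq F <- c | cmin C \in F] = 1%N.
  by rewrite size_filter -iC cov iC map_f // (negbTE CB).
rewrite iC in Ci; case: [seq F <- c | _] Ci => [|F [|? ?]] //=.
by rewrite inE => /eqP <- _; rewrite eqxx /min_block.
Qed.

Lemma labelingE n c : all min_first c -> compatible n (shapes c) (nonmins c) ->
  labeling n c
    = flatten [seq vertices_at (shapes c) (nonmins c) i | i <- iota 1 n].
Proof.
move=> mf cmp; congr flatten; apply/eq_in_map => i; exact: vertices_ofE.
Qed.

Lemma min_blockE s v : v \in min_block s -> v.1.1 = s.1 /\ (0 < v.1.2)%N.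
Proof.
rewrite /min_block; case: ifP => _; first by rewrite inE => /eqP ->.
by case/mapP=> j; rewrite mem_iota => /andP[j0 _] ->.
Qed.

Lemma vertices_at_label S B i v : v \in vertices_at S B i -> v.1.1 = i.
Proof.
rewrite mem_cat => /orP[/nseqP[-> //]|/flatten_mapP[s]].
by rewrite mem_filter => /andP[/eqP <- _] /min_blockE[].
Qed.

Lemma pairwise_min_block s : pairwise (fun u v => vlt u.1 v.1) (min_block s).
Proof.
rewrite /min_block; case: ifP => // _; rewrite pairwise_map.
apply: (sub_pairwise (r := ltn)) => [j k jk|].
  by rewrite /vlt /= eqxx ltnn.
by rewrite -(sorted_pairwise ltn_trans) iota_ltn_sorted.
Qed.

Lemma pairwise_vertices_at S B i : uniq (map fst S) ->
  pairwise (fun u v => vlt u.1 v.1) (vertices_at S B i).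
Proof.
move=> uS; rewrite pairwise_cat; apply/and3P; split.
- apply/allrelP => u v /nseqP[-> _] /flatten_mapP[s].
  rewrite mem_filter => /andP[/eqP si _] /min_blockE[vs v0].
  by rewrite /vlt /= vs si eqxx ltnn.
- by case: (_ \in _).
case: (boolP (i \in map fst S)) => [/mapP[s sS ->]|iS].
  by rewrite filter_shape //= cats0 pairwise_min_block.
by rewrite filter_shape0.
Qed.

Lemma pairwise_vertices S B m k : uniq (map fst S) ->
  pairwise (fun u v => vlt u.1 v.1)
    (flatten [seq vertices_at S B i | i <- iota m k]).
Proof.
move=> uS; elim: k m => //= k IH m; rewrite pairwise_cat IH andbT.
rewrite pairwise_vertices_at // andbT; apply/allrelP => u v /vertices_at_label um.
case/flatten_mapP=> i + /vertices_at_label vi; rewrite mem_iota => /andP[mi _].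
by rewrite /vlt um vi mi.
Qed.

Lemma rend_vertices S B m k :
  [seq v <- flatten [seq vertices_at S B i | i <- iota m k] | is_rend v]
    = [seq (i, 0%N, false) | i <- iota m k & i \in B].
Proof.
elim: k m => //= k IH m; rewrite filter_cat IH /vertices_at filter_cat.
rewrite filter_nseq mul1n; set M := [seq v <- flatten _ | _].
suff -> : M = [::] by rewrite cats0; case: (_ \in _).
apply/eqP; rewrite -size_eq0 size_filter -leqn0 leqNgt -has_count.
apply/hasPn => v /flatten_mapP[s _ /min_blockE[_]].
by rewrite /is_rend lt0n.
Qed.

(** Since the minima increase and lie in the range, scanning the integers [i] meets the cycles in
    the order of [S]. *)
Lemma min_vertices S B m k :
    sorted ltn (map fst S) -> all (mem (iota m k)) (map fst S) ->
  [seq v <- flatten [seq vertices_at S B i | i <- iota m k] | ~~ is_rend v]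
    = flatten (map min_block S).
Proof.
move=> sS rS; transitivity
  (flatten [seq flatten [seq min_block s | s <- S & s.1 == i] | i <- iota m k]).
  rewrite filter_flatten -map_comp; congr flatten; apply: eq_map => i /=.
  rewrite filter_cat filter_nseq /=; apply/all_filterP/allP => v.
  by case/flatten_mapP=> s _ /min_blockE[_]; rewrite /is_rend lt0n.
(* Either the first shape starts at [m] and the others beyond it, or all shapes start beyond [m]. *)
elim: k m S sS rS => [|k IH] m [|s S] //= sS.
  by move=> _; apply: (IH m.+1 [::]).
rewrite inE => /andP[sm rS].
have {sm} : s.1 = m \/ s.1 \in iota m.+1 k.
  by case/predU1P: sm; [left|right].
have gtS : {in S, forall t, (s.1 < t.1)%N}.
  by move=> t tS; apply: (allP (order_path_min ltn_trans sS)); apply: map_f.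
have rngS : (m <= s.1)%N -> all (mem (iota m.+1 k)) (map fst S).
  move=> ms; apply/allP => _ /mapP[t tS ->] /=.
  have := allP rS _ (map_f fst tS); rewrite /= inE => /predU1P[tm|//].
  by move: (leq_ltn_trans ms (gtS t tS)); rewrite tm ltnn.
case=> [sm|sm].
  rewrite sm eqxx /= filter_shape0; last first.
    by apply/negP => /mapP[t /gtS + tm]; rewrite -tm sm ltnn.
  rewrite cats0 -[in RHS](IH m.+1) ?(path_sorted sS) ?rngS ?sm //; congr cat.
  congr flatten; apply/eq_in_map => i; rewrite mem_iota => /andP[mi _].
  by rewrite ltn_eqF.
have ms : (m < s.1)%N by move: sm; rewrite mem_iota => /andP[].
rewrite gtn_eqF // filter_shape0 //=; last first.
  by apply/negP => /mapP[t /gtS + tm]; rewrite -tm; apply/negP; rewrite -leqNgt ltnW.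
by apply: (IH m.+1 (s :: S)) => //=; rewrite sm rngS // ltnW.
Qed.

(** The number of vertices gives the size, except that sizes 1 and 2 both produce one vertex; the
    isolation flag tells these apart. *)
Lemma min_block_inj s t : (0 < s.2)%N -> (0 < t.2)%N ->
  min_block s = min_block t -> s.1 = t.1 -> s = t.
Proof.
case: s t => [i [|[|k]]] [j [|[|l]]] //= _ _; rewrite /min_block /=; try by move=> + ->.
by move=> + ij; rewrite ij => /(congr1 size) /=; rewrite !size_map !size_iota => -[->].
Qed.

(** Positive sizes make all blocks nonempty. The first vertex then reveals the first minimum, and
    the vertices carrying that integer form the first block, since later minima are larger. *)
Lemma min_vertices_inj S S' :
    all (fun s => 0 < s.2)%N S -> all (fun s => 0 < s.2)%N S' ->
    sorted ltn (map fst S) -> sorted ltn (map fst S') ->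
  flatten (map min_block S) = flatten (map min_block S') -> S = S'.
Proof.
have hd s : (0 < s.2)%N -> exists b M, min_block s = (s.1, 1%N, b) :: M.
  by case: s => i [|[|k]] //= _; do 2!eexists.
have split_min s T : path ltn s.1 (map fst T) ->
    let M := flatten (map min_block (s :: T)) in
    [seq v <- M | v.1.1 == s.1] = min_block s
    /\ [seq v <- M | v.1.1 != s.1] = flatten (map min_block T).
  move=> sT /=; rewrite !filter_cat.
  have s1 : {in min_block s, forall v, v.1.1 == s.1}.
    by move=> v /min_blockE[->].
  have T1 : {in flatten (map min_block T), forall v, v.1.1 != s.1}.
    move=> v /flatten_mapP[t tT /min_blockE[-> _]]; rewrite gtn_eqF //.
    by apply: (allP (order_path_min ltn_trans sT)); apply: map_f.
  rewrite (all_filterP (introT allP s1)) (all_filterP (introT allP T1)).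
  rewrite (eq_in_filter (a2 := pred0)) => [|v /T1 /negbTE //].
  rewrite [X in _ /\ X ++ _ = _](eq_in_filter (a2 := pred0)) => [|v /s1 -> //].
  by rewrite !filter_pred0 cats0.
elim: S S' => [|s S IH] [|t T] //=.
- by move=> _ /andP[/hd[b [M ->]]].
- by move=> /andP[/hd[b [M ->]]].
move=> /andP[s0 S0] /andP[t0 T0] sS tT E.
have st : s.1 = t.1.
  by move: E; have [b [M ->]] := hd _ s0; have [b' [M' ->]] := hd _ t0; case.
have [s1 S1] := split_min _ _ sS; have [t1 T1] := split_min _ _ tT.
have /= Es : min_block s = min_block t by rewrite -s1 -t1 /= E st.
have ES : flatten (map min_block S) = flatten (map min_block T).
  by rewrite -S1 -T1 /= E st.
congr cons; first exact: min_block_inj.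
by apply: IH; rewrite ?(path_sorted sS) ?(path_sorted tT).
Qed.

Lemma lend_min_block s :
  [seq v <- min_block s | is_lend v] = [seq (s.1, j, false) | j <- iota 1 s.2.-1].
Proof.
rewrite /min_block; case: eqP => [->|_] //; apply/all_filterP/allP => v /mapP[j].
by rewrite mem_iota => /andP[j0 _] ->; rewrite /is_lend /= j0.
Qed.

Lemma lend_filter L :
  [seq v <- L | is_lend v] = [seq v <- [seq v <- L | ~~ is_rend v] | is_lend v].
Proof.
rewrite -filter_predI; apply: eq_filter => v /=; rewrite /is_lend /is_rend -lt0n.
by rewrite [RHS]andbAC andbb.
Qed.

(** * Linked cycles as matchings *)

(** The integers of the left endpoints, in step with [nonmins]: each tail entry is aligned with the
    minimum of its own cycle. *)
Definition openers (S : seq (nat * nat)) : seq nat :=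
  flatten [seq nseq s.2.-1 s.1 | s <- S].

(* The arcs leaving i^(1), ..., i^(t-1) end in the reverse of the order in which
   the cycle (i i_2 ... i_t) lists its elements, so concatenating the tails with
   the cycles reversed gives the right endpoints of the arcs by decreasing left
   endpoint. *)
Definition partners (c : seq (seq nat)) : seq nat := nonmins (rev c).

(** The sizes prescribe how to cut [f] into tails, and the entrywise inequality makes each tail
    exceed its minimum. *)
Lemma min_first_of_openers S f : all (fun s => 0 < s.2)%N S ->
    all2 ltn (openers S) f ->
  exists c, [/\ all min_first c, shapes c = S & nonmins c = f].
Proof.
elim: S f => [|[i k] S IH] f /=; first by case: f => // _ _; exists [::].
case: k => // k /andP[_ S0]; rewrite /openers /= => af.
have kf : (k <= size f)%N.
  by move: af; rewrite all2E size_cat size_nseq => /andP[/eqP <- _]; apply: leq_addr.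
have [D [g [fE Dk]]] : exists D g, f = D ++ g /\ size D = k.
  by exists (take k f), (drop k f); rewrite cat_take_drop size_takel.
move: af; rewrite fE -/(openers S); have -> : all2 ltn (nseq k i ++ openers S) (D ++ g)
    = all (ltn i) D && all2 ltn (openers S) g.
  by rewrite -Dk; elim: (D) => //= j E ->; rewrite andbA.
case/andP=> iD /(IH _ S0)[c [mf cS cg]]; exists ((i :: D) :: c); split.
- by rewrite /= mf andbT.
- by rewrite /shapes /= Dk; congr cons.
- by rewrite -cg.
Qed.

Lemma cycles_inj c c' : all min_first c -> all min_first c' ->
  shapes c = shapes c' -> nonmins c = nonmins c' -> c = c'.
Proof.
elim: c c' => [|[|m D] c IH] [|[|m' D'] c'] //= /andP[_ mc] /andP[_ mc'].
case=> -> sD; rewrite -/(shapes c) -/(shapes c') => cc /eqP.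
by rewrite /nonmins /= eqseq_cat // => /andP[/eqP -> /eqP /(IH _ mc mc' cc) ->].
Qed.

Lemma shapes_rev c : shapes (rev c) = rev (shapes c).
Proof. exact: map_rev. Qed.

Lemma perm_partners c : perm_eq (partners c) (nonmins c).
Proof. by apply/perm_flatten/perm_map; rewrite perm_rev. Qed.

Lemma openers_lt c : all min_first c -> all2 ltn (openers (shapes c)) (nonmins c).
Proof.
elim: c => //= C c IH /andP[mC /IH]; rewrite /openers /nonmins /=.
have [D [-> /= mD]] := min_firstP mC => {}IH.
by elim: D mD => //= i D IHD /andP[-> /IHD].
Qed.

Lemma map_fst_arcs c :
  map fst (arcs c)
    = map fst [seq v <- flatten (map min_block (shapes c)) | is_lend v].
Proof.
rewrite /arcs /shapes filter_flatten !map_flatten -!map_comp.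
congr flatten; apply: eq_map => C /=.
by rewrite lend_min_block -!map_comp.
Qed.

Lemma arc_lt c : all min_first c ->
  {in arcs c, forall a, a.2.2 = 0%N /\ (a.1.1 < a.2.1)%N}.
Proof.
move=> /allP mf a /flatten_mapP[C Cc /mapP[j + ->]]; rewrite mem_iota /=.
have [D [-> /allP /= mD]] := min_firstP (mf _ Cc); rewrite add1n => /andP[j0 jD].
(* As [1 <= j <= size D], the position [size C - j] is never that of the minimum, so the entry lies
   in [D]. *)
split=> //=; rewrite subSn //= mD // mem_nth // ltn_subrL j0.
by rewrite (leq_trans j0).
Qed.

Lemma map_snd_arcs c : [seq a.2.1 | a <- rev (arcs c)] = partners c.
Proof.
rewrite map_rev map_flatten -map_comp rev_flatten /partners /nonmins map_rev.
congr (flatten (rev _)); rewrite -map_comp; apply: eq_map => -[|m D] //=.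
rewrite -map_comp; apply: (can_inj revK); rewrite revK.
apply: (@eq_from_nth _ 0%N); first by rewrite size_map size_iota size_rev.
move=> k; rewrite size_map size_iota => kD.
rewrite (nth_map 0%N) ?size_iota // nth_iota //= add1n nth_rev //.
by rewrite subSS -subnSK.
Qed.

(** * Linked cycles sharing the labeling of a given one *)

Section FixedLabeling.

Variables (n : nat) (c : seq (seq nat)).
Hypothesis linked_c : is_linked_cycle n c.

Let mf : all min_first c.
Proof. by move: linked_c; rewrite linked_cycleE => /andP[]. Qed.

Let cmp : compatible n (shapes c) (nonmins c).
Proof. by move: linked_c; rewrite linked_cycleE => /andP[]. Qed.

Let sorted_mins : sorted ltn (map fst (shapes c)).
Proof. by case/and5P: cmp. Qed.

Let mins_range : all (mem (iota 1 n)) (map fst (shapes c)).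
Proof. by case/and5P: cmp => _ _ _; rewrite all_cat => /andP[]. Qed.

Lemma labeling_sorted : pairwise (fun u v => vlt u.1 v.1) (labeling n c).
Proof.
rewrite (labelingE mf cmp) pairwise_vertices //.
exact: sorted_uniq ltn_trans ltnn _ sorted_mins.
Qed.

Lemma not_rend_labeling :
  [seq v <- labeling n c | ~~ is_rend v] = flatten (map min_block (shapes c)).
Proof. by rewrite (labelingE mf cmp) min_vertices. Qed.

Lemma rends_labeling : rends (labeling n c) = [seq i <- iota 1 n | i \in nonmins c].
Proof.
by rewrite /rends (labelingE mf cmp) rend_vertices -map_comp map_id.
Qed.

Lemma perm_rends : perm_eq (nonmins c) (rends (labeling n c)).
Proof.
case/and5P: (cmp) => _ uB _ rB _; rewrite rends_labeling.
apply: uniq_perm => //; first by rewrite filter_uniq ?iota_uniq.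
move=> i; rewrite mem_filter andb_idr // => iB.
by apply: (allP rB); rewrite mem_cat iB orbT.
Qed.

Lemma lends_labeling : lends (labeling n c) = openers (shapes c).
Proof.
rewrite /openers /lends lend_filter not_rend_labeling filter_flatten map_flatten -!map_comp.
congr flatten; apply: eq_map => C /=; rewrite lend_min_block -map_comp.
by elim: (size C).-1 1%N => //= k IH m; rewrite IH.
Qed.

Lemma map_fst_arcs_lends :
  [seq a.1.1 | a <- rev (arcs c)] = rev (lends (labeling n c)).
Proof.
rewrite map_rev (map_comp fst fst) map_fst_arcs -not_rend_labeling -lend_filter.
by rewrite -map_comp.
Qed.

(** The left ends of [arcs c], in the order listed, are the left endpoints of the labeling from left
    to right. *)
Lemma arcs_sorted : pairwise (fun a b => vlt b.1 a.1) (rev (arcs c)).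
Proof.
have tr : transitive (fun a b : (nat * nat) * (nat * nat) => vlt b.1 a.1).
  by move=> a b d ba ad; apply: vlt_trans ba.
rewrite -(sorted_pairwise tr) rev_sorted.
have -> : sorted (fun a b => vlt a.1 b.1) (arcs c) = sorted vlt (map fst (arcs c)).
  by rewrite sorted_map.
rewrite map_fst_arcs -not_rend_labeling -lend_filter (sorted_pairwise vlt_trans).
rewrite pairwise_map; exact: pairwise_filter labeling_sorted.
Qed.

Lemma perm_rev_arcs : perm_eq (allpairs pair (arcs c) (arcs c))
  (allpairs pair (rev (arcs c)) (rev (arcs c))).
Proof. by apply: perm_allpairs; rewrite perm_sym perm_rev. Qed.

Lemma rev_arc_lt :
  {in rev (arcs c), forall a, a.2.2 = 0%N /\ (a.1.1 < a.2.1)%N}.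
Proof. by move=> a; rewrite mem_rev; apply: arc_lt. Qed.

Lemma cr2E : cr2 c = matching_cr (rev (lends (labeling n c))) (partners c).
Proof.
rewrite /cr2 (permP perm_rev_arcs) -map_fst_arcs_lends -map_snd_arcs.
exact: crossings_from_right arcs_sorted rev_arc_lt.
Qed.

Lemma ne2E : ne2 c = matching_ne (rev (lends (labeling n c))) (partners c).
Proof.
rewrite /ne2 (permP perm_rev_arcs) -map_fst_arcs_lends -map_snd_arcs.
exact: nestings_from_right arcs_sorted rev_arc_lt.
Qed.

(** Distinct minima bound the number of cycles by [n], and distinct entries bound the length of each
    cycle by [n], so the finite search misses no linked cycle. *)
Lemma cand_lc_linked : c \in cand_lc n.
Proof.
have uc := sorted_uniq ltn_trans ltnn sorted_mins.
have size_le (s : seq nat) : uniq s -> {subset s <= iota 1 n} -> (size s <= n)%N.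
  by move=> us /(uniq_leq_size us); rewrite size_iota.
rewrite mem_upto -[X in (X <= _)%N](size_map cmin) -map_fst_shapes size_le //=.
  apply/allP => C Cc; case/andP: linked_c => /allP /(_ _ Cc) /and4P[_ uC /allP rC _] _.
  have sC : {subset C <= iota 1 n} by move=> i /rC; rewrite mem_iota add1n ltnS.
  by rewrite /= mem_upto size_le //; apply/allP.
exact/allP.
Qed.

(** A cycle of size [t] contributes [t - 1] left endpoints and [t - 1] right endpoints. *)
Lemma size_lends_rends :
  size (rev (lends (labeling n c))) = size (rends (labeling n c)).
Proof.
rewrite size_rev lends_labeling -(perm_size perm_rends).
by have := openers_lt mf; rewrite all2E => /andP[/eqP].
Qed.

Lemma openers_rev_shapes : openers (shapes (rev c)) = rev (lends (labeling n c)).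
Proof.
rewrite lends_labeling /openers rev_flatten shapes_rev map_rev -map_comp.
by congr (flatten (rev _)); apply: eq_map => s /=; rewrite rev_nseq.
Qed.

Lemma mem_partners_matchings :
  partners c \in matchings (rev (lends (labeling n c))) (rends (labeling n c)).
Proof.
rewrite mem_matchings ?size_lends_rends //.
rewrite (perm_trans (perm_partners c) perm_rends) -openers_rev_shapes.
by apply: openers_lt; rewrite all_rev.
Qed.

(** Cutting [f] along the reversed shapes keeps all minima and sizes and merely permutes the
    non-minimal elements, whose order neither compatibility nor the labeling sees. *)
Lemma matching_realized f :
    f \in matchings (rev (lends (labeling n c))) (rends (labeling n c)) ->
  exists d, [/\ is_linked_cycle n d, labeling n d = labeling n c & partners d = f].
Proof.
rewrite mem_matchings ?size_lends_rends // => /andP[pf].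
rewrite -openers_rev_shapes => /min_first_of_openers[].
  apply/allP => _ /mapP[C + ->]; rewrite mem_rev => /(allP mf).
  by case/andP; rewrite -size_eq0 lt0n.
(* The matching lists the cycles by decreasing minima; reversal restores the increasing order. *)
move=> e [mfe se ne]; exists (rev e).
have sd : shapes (rev e) = shapes c by rewrite shapes_rev se shapes_rev revK.
have pd : perm_eq (nonmins c) (nonmins (rev e)).
  have := perm_partners (rev e); rewrite /partners revK ne.
  by move/(perm_trans _); apply; rewrite (permPl perm_rends) perm_sym.
have mfd : all min_first (rev e) by rewrite all_rev.
have cmpd : compatible n (shapes (rev e)) (nonmins (rev e)).
  by rewrite sd -(perm_compatible _ _ pd).
split; last by rewrite /partners revK.
  by rewrite linked_cycleE mfd.
rewrite (labelingE mfd cmpd) (labelingE mf cmp) sd; congr flatten.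
by apply: eq_map => i; rewrite /vertices_at (perm_mem pd).
Qed.

End FixedLabeling.

(** The vertices that are not right endpoints determine all minima and sizes, and then the partners
    determine the tails. *)
Lemma partners_inj n c d : is_linked_cycle n c -> is_linked_cycle n d ->
  labeling n c = labeling n d -> partners c = partners d -> c = d.
Proof.
move=> lc ld lcd pcd.
have := not_rend_labeling lc; rewrite lcd not_rend_labeling // => /esym bcd.
move: lc ld; rewrite !linked_cycleE => /andP[mc /and5P[sc _ _ _ _]] /andP[md /and5P[sd _ _ _ _]].
have pos e : all min_first e -> all (fun s => 0 < s.2)%N (shapes e).
  by rewrite all_map; apply: sub_all => C /andP[] /=; rewrite -size_eq0 lt0n.
have scd := min_vertices_inj (pos _ mc) (pos _ md) sc sd bcd.
apply: (can_inj revK); apply: cycles_inj; rewrite ?all_rev //.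
by rewrite !shapes_rev scd.
Qed.

(** Injectivity is [partners_inj] and surjectivity is [matching_realized]; both lists being
    duplicate-free, equal membership suffices. *)
Lemma perm_partners_matchings n c0 (L := labeling n c0) : is_linked_cycle n c0 ->
  perm_eq [seq partners c | c <- linked_cycles n & labeling n c == L]
          (matchings (rev (lends L)) (rends L)).
Proof.
move=> l0; apply: uniq_perm.
- rewrite map_inj_in_uniq => [|c d].
    by rewrite !filter_uniq // !uniq_upto // iota_uniq.
  rewrite !mem_filter => /and3P[/eqP lc cc _] /and3P[/eqP ld dd _].
  by apply: partners_inj cc dd _; rewrite lc.
- by rewrite uniq_matchings // /L rends_labeling // filter_uniq // iota_uniq.
move=> f; apply/mapP/idP => [[c + ->]|].
  rewrite !mem_filter => /and3P[/eqP lc cc _]; rewrite -lc.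
  exact: mem_partners_matchings.
case/(matching_realized l0) => d [ld Ld <-]; exists d => //.
by rewrite !mem_filter Ld eqxx ld cand_lc_linked.
Qed.

Lemma sorted_rev_lends n c : is_linked_cycle n c ->
  sorted geq (rev (lends (labeling n c))).
Proof.
move=> lc; rewrite rev_sorted (sorted_pairwise leq_trans) pairwise_map.
apply: (sub_pairwise (r := fun u v : label => vlt u.1 v.1)) => [u v|].
  by case/orP=> [/ltnW //|/andP[/eqP /= ->]].
exact: pairwise_filter (labeling_sorted lc).
Qed.

Lemma sum_cr2_ne2 n c0 (L := labeling n c0) (R : comPzRingType) (x y : R) :
    is_linked_cycle n c0 ->
  \sum_(c <- linked_cycles n | labeling n c == L) x ^+ cr2 c * y ^+ ne2 c
    = \prod_(k < size L | is_lend (nth (0%N, 0%N, false) L k))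
        hpoly x y (hval L k).
Proof.
move=> l0; rewrite prod_hval ?labeling_sorted // -(size_rev (lends L)).
rewrite -sum_matchings ?size_lends_rends ?sorted_rev_lends //; last first.
  by rewrite rends_labeling // filter_uniq // iota_uniq.
(* The sum over matchings is transported along the bijection [partners], which preserves both
   statistics. *)
rewrite -(perm_big _ (perm_partners_matchings l0)) big_map big_filter /=.
rewrite big_seq_cond [RHS]big_seq_cond; apply: eq_bigr => c /andP[+ /eqP lc].
by rewrite mem_filter => /andP[cc _]; rewrite (cr2E cc) (ne2E cc) lc.
Qed.

Theorem theorem4p9 (n : nat) (L : seq label) (R : comPzRingType) (x y : R) :
  (1 <= n)%N ->
  (exists c, is_linked_cycle n c /\ labeling n c = L) ->
  (\sum_(c <- linked_cycles n | labeling n c == L) x ^+ cr2 c * y ^+ ne2 c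
     = \prod_(k < size L | is_lend (nth (0%N, 0%N, false) L k))
          hpoly x y (hval L k))
  /\
  (\sum_(c <- linked_cycles n | labeling n c == L) x ^+ ne2 c * y ^+ cr2 c
     = \prod_(k < size L | is_lend (nth (0%N, 0%N, false) L k))
          hpoly x y (hval L k)).
Proof.
move=> _ [c0 [l0 <-]]; split; first exact: sum_cr2_ne2.
(* Exchanging [x] and [y] reduces this to the first identity, as each factor [hpoly] is
   symmetric. *)
under eq_bigr do rewrite mulrC.
by rewrite sum_cr2_ne2 //; under eq_bigr do rewrite hpolyC.
Qed.
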